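(* Let $0<\alpha<1$ and $\mu,\kappa\in\mathbb{C}$ with $\mathrm{Re}(\mu)>0$, $\mathrm{Re}(\kappa)>0$. For every $t>0$, the truncated $\mathcal{V}$-fractional derivative of order $\alpha$ of the two-parameter Mittag-Leffler function $\mathbb{E}_{\mu,\kappa}$ satisfies $${}_{i}^{\rho}\mathcal{V}_{\gamma,\beta,\alpha}^{\delta,p,q}\big(\mathbb{E}_{\mu,\kappa}(t)\big)=t^{1-\alpha}\,\frac{\Gamma(\beta)(\rho)_q}{\Gamma(\gamma+\beta)(\delta)_p}\;\mathbb{E}_{\mu,\mu+\kappa}^{2}(t),$$ where $\mathbb{E}_{\mu,\mu+\kappa}^{2}$ is the three-parameter Mittag-Leffler function with upper parameter $2$.
   Context: Mittag-Leffler functions: $\mathbb{E}_{\mu,\kappa}(z)=\sum_{k=0}^\infty \frac{z^k}{\Gamma(\mu k+\kappa)}$ and $\mathbb{E}_{\mu,\kappa}^{\sigma}(z)=\sum_{k=0}^\infty \frac{(\sigma)_k}{k!}\frac{z^k}{\Gamma(\mu k+\kappa)}$ (superscript is a parameter, not a power). Parameters: $\gamma,\beta,\rho,\delta\in\mathbb{C}$ with $\mathrm{Re}(\gamma),\mathrm{Re}(\beta),\mathrm{Re}(\rho),\mathrm{Re}(\delta)>0$, real $p,q>0$ with $\mathrm{Re}(\gamma)+p\ge q$, and an integer $i\ge 1$. For real $s\ge 0$ put $(z)_s:=\Gamma(z+s)/\Gamma(z)$. Define $${}_{i}H_{\gamma,\beta,p}^{\rho,\delta,q}(z):=\Gamma(\beta)\sum_{k=0}^{i}\frac{(\rho)_{qk}}{(\delta)_{pk}}\frac{z^k}{\Gamma(\gamma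 k+\beta)}.$$ The parameters are assumed to be such that the coefficients of this polynomial are real (e.g. all parameters real). The truncated $\mathcal{V}$-fractional derivative of order $\alpha$ at $t>0$ of a (real- or complex-valued) function $f$ on $[0,\infty)$ is $${}_{i}^{\rho}\mathcal{V}_{\gamma,\beta,\alpha}^{\delta,p,q}f(t):=\lim_{\varepsilon\to 0}\frac{f\big(t\,{}_{i}H_{\gamma,\beta,p}^{\rho,\delta,q}(\varepsilon t^{-\alpha})\big)-f(t)}{\varepsilon}$$ (with $\varepsilon$ real). *)

(* Defs.v *)
From Stdlib Require Export Reals Factorial.
From Coquelicot Require Export Coquelicot.

Open Scope R_scope.

(* Principal power x^z for real x > 0. *)
Definition cpower (x : R) (z : C) : C :=
  (Rpower x (Re z) * cos (Im z * ln x), Rpower x (Re z) * sin (Im z * ln x)).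

Definition Gamma_integrand (z : C) (x : R) : C :=
  (RtoC (exp (- x)) * cpower x (z - 1))%C.

(* Euler's integral over (0, +oo), taken componentwise.  It represents the
   Gamma function only for Re z > 0. *)
Definition CGamma (z : C) : C :=
  (RInt_gen (fun x => Re (Gamma_integrand z x)) (at_right 0) (Rbar_locally p_infty),
   RInt_gen (fun x => Im (Gamma_integrand z x)) (at_right 0) (Rbar_locally p_infty)).

(* (z)_s for a real index s >= 0. *)
Definition poch (z : C) (s : R) : C := (CGamma (z + RtoC s) / CGamma z)%C.

Definition CSeries (a : nat -> C) : C :=
  (Series (fun k => Re (a k)), Series (fun k => Im (a k))).

Definition ML2 (mu kappa z : C) : C :=
  CSeries (fun k => (Cpow z k / CGamma (mu * RtoC (INR k) + kappa))%C).

(* The parameter sigma is the superscript; poch requires Re sigma > 0. *)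
Definition ML3 (sigma mu kappa z : C) : C :=
  CSeries (fun k => (poch sigma (INR k) / RtoC (INR (fact k))
                     * (Cpow z k / CGamma (mu * RtoC (INR k) + kappa)))%C).

Definition H_coef (gamma beta rho delta : C) (p q : R) (k : nat) : C :=
  (CGamma beta * (poch rho (q * INR k) / poch delta (p * INR k)
                  / CGamma (gamma * RtoC (INR k) + beta)))%C.

Definition H_trunc (i : nat) (gamma beta rho delta : C) (p q : R) (z : C) : C :=
  sum_n (fun k => (H_coef gamma beta rho delta p q k * Cpow z k)%C) i.

(* "The derivative of f at t exists and equals l."  Meant for polynomials
   H_trunc with real coefficients: H_trunc is then real at real arguments and
   Re merely casts its value to R.  Since the argument of f tends to t > 0,
   only the values of f on [0, +oo) matter. *)
Definition is_V_derivative (i : nat) (gamma beta rho delta : C) (p q alpha : R)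
    (f : R -> C) (t : R) (l : C) : Prop :=
  filterlim
    (fun eps : R =>
       ((f (t * Re (H_trunc i gamma beta rho delta p q
                      (RtoC (eps * Rpower t (- alpha)))))%R - f t) / RtoC eps)%C)
    (locally' 0) (locally l).

(* Main.v *)
Require Import Defs.
From Stdlib Require Import Lra Lia.

(* Since [H] is a polynomial with [H 0 = 1] and real coefficient [h] of degree one, the map
   [e |-> t H (e t ^ (- alpha))] takes the value [t] at [0] with derivative [h t ^ (1 - alpha)];
   the theorem is then the chain rule together with termwise differentiation of the
   Mittag-Leffler series and [(2)_k / k! = k + 1].

   Both ingredients need lower bounds on Euler's integral.  With [X] Gamma-distributed of
   parameter [s], [Gamma (s + i y) / Gamma s] is the mean of [X ^ (i y)]; concentration of [X]
   around [s] gives [|Gamma (s + i y)| >= Gamma s (1 - 2 y^2 / (s - 1))].  The functional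
   equation spreads this to [|Gamma (s + i y)| >= Gamma s e ^ (- y^2 / (2 (s - 1))) / 2] for all
   [s > 1].  Hence Gamma has no zero in the right half-plane, and it grows superexponentially
   along [mu n + kappa], so the power series converges everywhere. *)

(** * Improper integrals over the positive half-line *)

Local Notation F0 := (at_right 0).
Local Notation Foo := (Rbar_locally p_infty).

Lemma filter_prod_pos (P : R * R -> Prop) :
  (forall a b, 0 < a < b -> P (a, b)) -> filter_prod F0 Foo P.
Proof.
  intros H.
  (* Cutting at [1] separates the endpoints: [0 < a < 1 < b]. *)
  apply (Filter_prod F0 Foo _ (fun a => 0 < a < 1) (fun b => 1 < b)).
  - exists (mkposreal 1 Rlt_0_1). intros y Hy Hy0.
    change (Rabs (y - 0) < 1) in Hy. apply Rabs_def2 in Hy. lra.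
  - exists 1. intros x Hx; exact Hx.
  - intros a b Ha Hb. apply H. lra.
Qed.

Lemma is_RInt_gen_pos_ext (f g : R -> R) (l : R) :
  (forall x, 0 < x -> f x = g x) ->
  is_RInt_gen f F0 Foo l -> is_RInt_gen g F0 Foo l.
Proof.
  intros H. apply is_RInt_gen_ext. apply filter_prod_pos.
  simpl. intros a b Hab x Hx. apply H. rewrite Rmin_left in Hx; lra.
Qed.

(** The norm inequality, applied to [g - f] as its own majorant, yields [|lg - lf| <= lg - lf]. *)
Lemma is_RInt_gen_pos_le (f g : R -> R) (lf lg : R) :
  (forall x, 0 < x -> f x <= g x) ->
  is_RInt_gen f F0 Foo lf -> is_RInt_gen g F0 Foo lg -> lf <= lg.
Proof.
  intros H Hf Hg.
  assert (Hd := is_RInt_gen_minus _ _ _ _ Hg Hf).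
  assert (Hn := fun Hab Hle => RInt_gen_norm _ _ _ _ Hab Hle Hd Hd).
  assert (K : Rabs (lg - lf) <= lg - lf).
  { apply Hn; apply filter_prod_pos; simpl; intros a b Hab; [lra|].
    intros x Hx. change (Rabs (g x - f x) <= g x - f x).
    rewrite Rabs_pos_eq; [lra|]. specialize (H x). lra. }
  pose proof (Rabs_pos (lg - lf)). lra.
Qed.

Lemma is_RInt_gen_pos_derive (F f : R -> R) (l0 l1 : R) :
  (forall x, 0 < x -> is_derive F x (f x)) ->
  (forall x, 0 < x -> continuous f x) ->
  filterlim F F0 (locally l0) -> filterlim F Foo (locally l1) ->
  is_RInt_gen f F0 Foo (l1 - l0).
Proof.
  intros HF Hf H0 H1.
  apply is_RInt_gen_pos_ext with (Derive F).
  { intros x Hx. apply is_derive_unique, HF, Hx. }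
  apply is_RInt_gen_Derive; trivial; apply filter_prod_pos; simpl;
    intros a b Hab x Hx; rewrite Rmin_left in Hx by lra.
  - exists (f x). apply HF. lra.
  (* [Derive F] agrees with [f] on the ball of radius [x] around [x], which stays inside the
     positive half-line. *)
  - apply continuous_ext_loc with f; [|apply Hf; lra].
    assert (Hx0 : 0 < x) by lra.
    exists (mkposreal x Hx0). intros y Hy.
    change (Rabs (y - x) < x) in Hy. apply Rabs_def2 in Hy.
    symmetry. apply is_derive_unique, HF. lra.
Qed.

(** Cauchy criterion on the product filter: the integral of [f] between two points is bounded by the
    increment of [G], and [G] has a limit at both ends. *)
Lemma ex_RInt_gen_pos_dominated (f G g : R -> R) (l0 l1 : R) :
  (forall x, 0 < x -> continuous f x) ->
  (forall x, 0 < x -> is_derive G x (g x)) ->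
  (forall x, 0 < x -> continuous g x) ->
  (forall x, 0 < x -> Rabs (f x) <= g x) ->
  filterlim G F0 (locally l0) -> filterlim G Foo (locally l1) ->
  ex_RInt_gen f F0 Foo.
Proof.
  intros Hf HG Hg Hfg H0 H1.
  assert (Hex : forall h : R -> R, (forall x, 0 < x -> continuous h x) ->
            forall a b, 0 < a -> 0 < b -> ex_RInt h a b).
  { intros h Hh a b Ha Hb. apply (ex_RInt_continuous (V := R_CompleteNormedModule)).
    intros x Hx. apply Hh. apply Rlt_le_trans with (2 := proj1 Hx).
    apply Rmin_glb_lt; assumption. }
  assert (Hb1 : forall a b, 0 < a -> a <= b -> Rabs (RInt f a b) <= G b - G a).
  { intros a b Ha Hab.
    assert (HI : is_RInt g a b (G b - G a)).
    { apply (is_RInt_derive (V := R_CompleteNormedModule));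
      intros x Hx; rewrite Rmin_left in Hx by lra; [apply HG|apply Hg]; lra. }
    assert (HfI : is_RInt f a b (RInt f a b)).
    { apply (RInt_correct (V := R_CompleteNormedModule)). apply Hex; trivial; lra. }
    refine (norm_RInt_le f g a b _ _ Hab _ HfI HI).
    intros x Hx. apply Hfg. lra. }
  assert (Hb2 : forall a b, 0 < a -> 0 < b -> Rabs (RInt f a b) <= Rabs (G b - G a)).
  { intros a b Ha Hb. destruct (Rle_dec a b) as [Hab|Hab].
    - eapply Rle_trans; [apply Hb1; trivial|]. apply Rle_abs.
    - rewrite <- (opp_RInt_swap (V := R_CompleteNormedModule)) by (apply Hex; trivial).
      change (Rabs (- RInt f b a) <= Rabs (G b - G a)).
      rewrite Rabs_Ropp, Rabs_minus_sym.
      eapply Rle_trans; [apply Hb1; trivial; lra|]. apply Rle_abs. }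
  assert (Hlim : exists y : R, filterlim (fun ab => RInt f (fst ab) (snd ab))
                  (filter_prod F0 Foo) (locally y)).
  { apply (filterlim_locally_cauchy (U := R_CompleteSpace)). intros eps.
    (* Two values of [G] within [eps / 4] of the same limit differ by less than [eps / 2], and
       moving each of the two endpoints costs one such difference. *)
    assert (He : 0 < eps / 4) by (generalize (cond_pos eps); lra).
    set (e := mkposreal _ He).
    exists (fun ab => (0 < fst ab /\ Rabs (G (fst ab) - l0) < e) /\
                      (0 < snd ab /\ Rabs (G (snd ab) - l1) < e)).
    split.
    - apply (Filter_prod F0 Foo _ (fun a => 0 < a /\ Rabs (G a - l0) < e)
                                  (fun b => 0 < b /\ Rabs (G b - l1) < e)).
      + apply filter_and.
        * exists (mkposreal 1 Rlt_0_1). intros y _ Hy. exact Hy.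
        * apply (H0 (fun y => Rabs (y - l0) < e)). exists e. intros y Hy. exact Hy.
      + apply filter_and.
        * exists 0. intros y Hy. exact Hy.
        * apply (H1 (fun y => Rabs (y - l1) < e)). exists e. intros y Hy. exact Hy.
      + intros; split; assumption.
    - intros [a b] [a' b']; simpl. intros [[Ha Ga] [Hb Gb]] [[Ha' Ga'] [Hb' Gb']].
      change (Rabs (RInt f a' b' - RInt f a b) < eps).
      assert (HC1 : RInt f a' b' = RInt f a' a + RInt f a b').
      { symmetry. apply (RInt_Chasles (V := R_CompleteNormedModule)); apply Hex; trivial. }
      assert (HC2 : RInt f a b' = RInt f a b + RInt f b b').
      { symmetry. apply (RInt_Chasles (V := R_CompleteNormedModule)); apply Hex; trivial. }
      assert (B1 := Hb2 a' a Ha' Ha). assert (B2 := Hb2 b b' Hb Hb').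
      assert (T1 : Rabs (G a - G a') < eps / 2).
      { apply Rabs_def2 in Ga; apply Rabs_def2 in Ga'. apply Rabs_def1; lra. }
      assert (T2 : Rabs (G b' - G b) < eps / 2).
      { apply Rabs_def2 in Gb; apply Rabs_def2 in Gb'. apply Rabs_def1; lra. }
      rewrite HC1, HC2.
      replace (RInt f a' a + (RInt f a b + RInt f b b') - RInt f a b)
        with (RInt f a' a + RInt f b b') by ring.
      eapply Rle_lt_trans; [apply Rabs_triang|]. lra. }
  destruct Hlim as [l Hl]. exists l.
  apply (filterlimi_lim_ext_loc (fun ab => RInt f (fst ab) (snd ab))); trivial.
  apply filter_prod_pos. intros a b Hab.
  apply (RInt_correct (V := R_CompleteNormedModule)). apply Hex; [exact Hf|simpl; lra|simpl; lra].
Qed.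

(** * Convergence of Euler's integral *)

Lemma filterlim_Rpower_0 (s : R) : 0 < s ->
  filterlim (fun x => Rpower x s) F0 (locally 0).
Proof.
  intros Hs. unfold Rpower.
  apply (filterlim_comp _ _ _ (fun x => s * ln x) exp _ (Rbar_locally m_infty)).
  - apply (filterlim_comp _ _ _ ln (fun y => s * y) _ (Rbar_locally m_infty)).
    + exact is_lim_ln_0.
    + intros P [M HM]. exists (M / s). intros v Hv. apply HM.
      apply Rlt_div_r in Hv; lra.
  - exact is_lim_exp_m.
Qed.

Lemma filterlim_Rpower_p_infty (s : R) : 0 < s ->
  filterlim (fun x => Rpower x s) Foo Foo.
Proof.
  intros Hs. unfold Rpower.
  apply (filterlim_comp _ _ _ (fun x => s * ln x) exp _ Foo).
  - apply (filterlim_comp _ _ _ ln (fun y => s * y) _ Foo).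
    + exact is_lim_ln_p.
    + intros P [M HM]. exists (M / s). intros v Hv. apply HM.
      apply Rlt_div_l in Hv; lra.
  - exact is_lim_exp_p.
Qed.

(** The maximum of [x ^ c e ^ (- x)] is attained at [x = c]; this follows from
    [1 + ln (x / c) <= x / c]. *)
Lemma exp_Rpower_bound (c x : R) : 0 < c -> 0 < x ->
  exp (- x) * Rpower x c <= exp (- c) * Rpower c c.
Proof.
  intros Hc Hx. unfold Rpower. rewrite <- !exp_plus. 
  assert (H := exp_ineq1_le (ln (x / c))).
  rewrite exp_ln in H by (apply Rdiv_lt_0_compat; lra).
  rewrite ln_div in H by lra.
  assert (E : c * (1 + (ln x - ln c)) <= x).
  { replace x with (c * (x / c)) at 2 by (field; lra).
    apply Rmult_le_compat_l; lra. }
  assert (L : - x + c * ln x <= - c + c * ln c) by lra.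
  destruct L as [L|L]; [left; apply exp_increasing; exact L|rewrite L; right; reflexivity].
Qed.

Lemma filterlim_squeeze_0 (F : (R -> Prop) -> Prop) (f h : R -> R) :
  Filter F -> F (fun x => Rabs (f x) <= h x) ->
  filterlim h F (locally 0) -> filterlim f F (locally 0).
Proof.
  intros HF Hle Hh. apply filterlim_locally. intros eps.
  assert (Hb : F (fun x => Rabs (h x - 0) < eps)).
  { apply (Hh (fun v => Rabs (v - 0) < eps)). exists eps. trivial. }
  generalize (filter_and _ _ Hle Hb). apply filter_imp.
  intros x [H1 H2].
  change (Rabs (f x - 0) < eps). rewrite Rminus_0_r in *.
  apply Rle_lt_trans with (2 := H2). apply Rle_trans with (1 := H1). apply Rle_abs.
Qed.

(** The real part of [e ^ (i phi)] times Euler's integrand at [s + i y]. The phase lets one real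
    function serve for the real part ([phi = 0]), the imaginary part ([phi = - PI / 2]) and all
    rotations. *)
Definition gamma_wave (s y phi x : R) : R :=
  exp (- x) * Rpower x (s - 1) * cos (y * ln x + phi).

Lemma Rabs_mult_cos_le (a b : R) : 0 <= a -> Rabs (a * cos b) <= a.
Proof.
  intros Ha. rewrite Rabs_mult, (Rabs_pos_eq a) by trivial.
  rewrite <- (Rmult_1_r a) at 2. apply Rmult_le_compat_l; trivial.
  apply Rabs_le. apply COS_bound.
Qed.

Lemma Rpower_pos (x s : R) : 0 < Rpower x s.
Proof. apply exp_pos. Qed.

Lemma gamma_wave_continuous (s y phi x : R) : 0 < x ->
  continuous (gamma_wave s y phi) x.
Proof.
  intros Hx. apply (ex_derive_continuous (V := R_NormedModule)).
  unfold gamma_wave, Rpower. auto_derive. tauto.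
Qed.

(* The wave is dominated by the derivative of a multiple of [x ^ s / (1 + x ^ s)]. *)
Lemma ex_RInt_gen_gamma_wave (s y phi : R) : 0 < s ->
  ex_RInt_gen (gamma_wave s y phi) F0 Foo.
Proof.
  intros Hs.
  (* With [u = x ^ s], the bounds [(1 + u) ^ 2 <= 2 + 2 u ^ 2] and [e ^ (- x) u ^ 2 <= e ^ (- 2 s)
     (2 s) ^ (2 s)] give [e ^ (- x) (1 + u) ^ 2 <= K s]. *)
  set (K := (2 + 2 * (exp (- (2 * s)) * Rpower (2 * s) (2 * s))) / s).
  set (L := fun u => K * (1 - / (1 + u))).
  apply (ex_RInt_gen_pos_dominated _ (fun x => L (Rpower x s))
           (fun x => K * (s * Rpower x (s - 1)) / (1 + Rpower x s) ^ 2) (L 0) K).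
  - apply gamma_wave_continuous.
  - intros x Hx. unfold L, Rpower. assert (E := exp_pos (s * ln x)).
    auto_derive. { repeat split; trivial. lra. }
    replace ((s - 1) * ln x) with (s * ln x + - ln x) by ring.
    rewrite exp_plus, exp_Ropp, exp_ln by trivial. field. lra.
  - intros x Hx. apply (ex_derive_continuous (V := R_NormedModule)).
    unfold Rpower. assert (E := exp_pos (s * ln x)).
    auto_derive. repeat split; trivial. nra.
  - intros x Hx. unfold gamma_wave.
    assert (P1 := Rpower_pos x (s - 1)). assert (P2 := Rpower_pos x s).
    assert (P3 := exp_pos (- x)).
    eapply Rle_trans.
    { apply Rabs_mult_cos_le. apply Rlt_le, Rmult_lt_0_compat; trivial. }
    assert (Hu : Rpower x s * Rpower x s = Rpower x (2 * s)).
    { rewrite <- Rpower_plus. f_equal. ring. }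
    assert (HB : exp (- x) * Rpower x (2 * s) <= _) by (apply exp_Rpower_bound; lra).
    assert (He1 : exp (- x) <= 1).
    { rewrite <- exp_0. left. apply exp_increasing. lra. }
    assert (HK : exp (- x) * (1 + Rpower x s) ^ 2 <= K * s).
    { replace (K * s) with (2 + 2 * (exp (- (2 * s)) * Rpower (2 * s) (2 * s)))
        by (unfold K; field; lra).
      rewrite <- Hu in HB. set (u := Rpower x s) in *.
      assert (exp (- x) * (1 + u) ^ 2 <= exp (- x) * (2 + 2 * (u * u))).
      { apply Rmult_le_compat_l; [lra|]. generalize (pow2_ge_0 (1 - u)). lra. }
      lra. }
    apply -> Rle_div_r; [|apply pow_lt; lra].
    apply Rle_trans with (Rpower x (s - 1) * (exp (- x) * (1 + Rpower x s) ^ 2)); [right; ring|].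
    apply Rle_trans with (Rpower x (s - 1) * (K * s)); [|right; ring].
    apply Rmult_le_compat_l; lra.
  - apply (filterlim_comp _ _ _ (fun x => Rpower x s) L _ (locally 0)).
    + apply filterlim_Rpower_0, Hs.
    + apply (ex_derive_continuous (V := R_NormedModule) L). unfold L. auto_derive. lra.
  - apply (filterlim_comp _ _ _ (fun x => Rpower x s) L _ Foo).
    + apply filterlim_Rpower_p_infty, Hs.
    + apply (filterlim_comp _ _ _ (fun u => / (1 + u)) (fun v => K * (1 - v)) _ (locally 0)).
      * apply (filterlim_comp _ _ _ (fun u => 1 + u) Rinv _ Foo).
        -- intros P [M HM]. exists M. intros u Hu. apply HM. lra.
        -- apply (filterlim_Rbar_inv p_infty). discriminate.
      * assert (Hc : continuous (fun v : R => K * (1 - v)) 0).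
        { apply (ex_derive_continuous (V := R_NormedModule)). auto_derive. trivial. }
        unfold continuous in Hc. replace (K * (1 - 0)) with K in Hc by ring. exact Hc.
Qed.

(* The real part of [e ^ (i phi) Gamma z]. *)
Definition gamma_phase (z : C) (phi : R) : R :=
  cos phi * Re (CGamma z) - sin phi * Im (CGamma z).

(** Convergence makes the [RInt_gen] in [CGamma] genuine integrals. The phases [0] and [- PI / 2]
    give the two components, and the addition formula for the cosine combines them into any
    phase. *)
Lemma is_RInt_gen_gamma_phase (z : C) (phi : R) : 0 < Re z ->
  is_RInt_gen (gamma_wave (Re z) (Im z) phi) F0 Foo (gamma_phase z phi).
Proof.
  intros Hz.
  assert (HI : forall psi, is_RInt_gen (gamma_wave (Re z) (Im z) psi) F0 Foo
             (RInt_gen (gamma_wave (Re z) (Im z) psi) F0 Foo)).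
  { intros psi. apply (RInt_gen_correct (V := R_CompleteNormedModule)).
    apply ex_RInt_gen_gamma_wave, Hz. }
  assert (HRe : is_RInt_gen (gamma_wave (Re z) (Im z) 0) F0 Foo (Re (CGamma z))).
  { replace (Re (CGamma z)) with (RInt_gen (gamma_wave (Re z) (Im z) 0) F0 Foo); [apply HI|].
    symmetry. apply (is_RInt_gen_unique (V := R_CompleteNormedModule)).
    apply is_RInt_gen_pos_ext with (2 := HI 0).
    intros x Hx. unfold gamma_wave, Gamma_integrand, cpower. destruct z as [s y].
    simpl. rewrite !Rplus_0_r, Ropp_0, Rplus_0_r. unfold Rminus. ring. }
  assert (HIm : is_RInt_gen (gamma_wave (Re z) (Im z) (- (PI / 2))) F0 Foo (Im (CGamma z))).
  { replace (Im (CGamma z)) with (RInt_gen (gamma_wave (Re z) (Im z) (- (PI / 2))) F0 Foo);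
      [apply HI|].
    symmetry. apply (is_RInt_gen_unique (V := R_CompleteNormedModule)).
    apply is_RInt_gen_pos_ext with (2 := HI (- (PI / 2))).
    intros x Hx. unfold gamma_wave, Gamma_integrand, cpower. destruct z as [s y].
    simpl. rewrite Ropp_0, Rplus_0_r. unfold Rminus.
    replace (cos (y * ln x + - (PI / 2))) with (sin (y * ln x)).
    - ring.
    - rewrite <- cos_shift, <- cos_neg. f_equal. ring. }
  assert (H := is_RInt_gen_minus _ _ _ _ (is_RInt_gen_scal _ (cos phi) _ HRe)
                 (is_RInt_gen_scal _ (sin phi) _ HIm)).
  apply is_RInt_gen_pos_ext with (2 := H).
  intros x Hx. change (cos phi * gamma_wave (Re z) (Im z) 0 x
     - sin phi * gamma_wave (Re z) (Im z) (- (PI / 2)) x = gamma_wave (Re z) (Im z) phi x).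
  unfold gamma_wave. rewrite !cos_plus, cos_0, sin_0, cos_neg, sin_neg, cos_PI2, sin_PI2.
  ring.
Qed.

(** * The functional equation *)

Lemma CGamma_eq (z w : C) :
  (forall phi, gamma_phase z phi = cos phi * Re w - sin phi * Im w) -> CGamma z = w.
Proof.
  (* Phase [0] recovers the real part, phase [PI / 2] the opposite of the imaginary part. *)
  intros H. assert (H0 := H 0). assert (H1 := H (PI / 2)).
  unfold gamma_phase in *. rewrite cos_0, sin_0 in H0. rewrite cos_PI2, sin_PI2 in H1.
  destruct (CGamma z) as [a b], w as [c d]. simpl in *. f_equal; lra.
Qed.

(** Integration by parts: the derivative of [x ^ s e ^ (- x) cos (y ln x + phi)] integrates to [0].
    The factor [i] in [z = s + i y] appears as the phase shift by [PI / 2]. *)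
Lemma CGamma_plus_1 (z : C) : 0 < Re z -> CGamma (z + 1)%C = (z * CGamma z)%C.
Proof.
  intros Hz. apply CGamma_eq. intros phi.
  assert (Hz1 : 0 < Re (z + 1)%C) by (destruct z; simpl in *; lra).
  assert (I1 := is_RInt_gen_gamma_phase _ phi Hz1).
  assert (I2 := is_RInt_gen_gamma_phase _ phi Hz).
  assert (I3 := is_RInt_gen_gamma_phase _ (phi + PI / 2) Hz).
  destruct z as [s y]. simpl in Hz, Hz1, I1, I2, I3. rewrite Rplus_0_r in I1.
  assert (I : is_RInt_gen (fun x => s * gamma_wave s y phi x
                + y * gamma_wave s y (phi + PI / 2) x - gamma_wave (s + 1) y phi x)
                F0 Foo (0 - 0)).
  { apply is_RInt_gen_pos_derive with (gamma_wave (s + 1) y phi).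
    - intros x Hx. unfold gamma_wave, Rpower. auto_derive. { tauto. }
      replace (y * ln x + (phi + PI / 2)) with (PI / 2 + (y * ln x + phi)) by ring.
      rewrite (cos_plus (PI / 2)), cos_PI2, sin_PI2.
      replace ((s + 1 - 1) * ln x) with ((s - 1) * ln x + ln x) by ring.
      rewrite exp_plus, exp_ln by trivial. field. lra.
    - intros x Hx. apply (ex_derive_continuous (V := R_NormedModule)).
      unfold gamma_wave, Rpower. auto_derive. tauto.
    - apply filterlim_squeeze_0 with (fun x => Rpower x s); [typeclasses eauto| |].
      + exists (mkposreal 1 Rlt_0_1). intros x _ Hx.
        unfold gamma_wave. replace (s + 1 - 1) with s by ring.
        assert (P2 := Rpower_pos x s). assert (P3 := exp_pos (- x)).
        assert (He1 : exp (- x) <= 1).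
        { rewrite <- exp_0. left. apply exp_increasing. lra. }
        eapply Rle_trans; [apply Rabs_mult_cos_le; nra|]. nra.
      + apply filterlim_Rpower_0, Hz.
    (* [M] is the maximum of [x ^ (s + 1) e ^ (- x)], so the boundary term at infinity is at most
       [M / x]. *)
    - set (M := exp (- (s + 1)) * Rpower (s + 1) (s + 1)).
      apply filterlim_squeeze_0 with (fun x => M * / x); [typeclasses eauto| |].
      + exists 0. intros x Hx.
        unfold gamma_wave. replace (s + 1 - 1) with s by ring.
        assert (P2 := Rpower_pos x s). assert (P3 := exp_pos (- x)).
        eapply Rle_trans; [apply Rabs_mult_cos_le; nra|].
        apply -> Rle_div_r; [|lra]. rewrite Rmult_assoc.
        rewrite <- (Rpower_1 x Hx) at 3. rewrite <- Rpower_plus.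
        apply exp_Rpower_bound; lra.
      + apply (filterlim_comp _ _ _ Rinv (fun v => M * v) _ (locally 0)).
        * apply (filterlim_Rbar_inv p_infty). discriminate.
        * assert (Hc : continuous (fun v : R => M * v) 0).
          { apply (ex_derive_continuous (V := R_NormedModule)). auto_derive. trivial. }
          unfold continuous in Hc. rewrite Rmult_0_r in Hc. exact Hc. }
  assert (J := is_RInt_gen_minus _ _ _ _ (is_RInt_gen_plus _ _ _ _
     (is_RInt_gen_scal _ s _ I2) (is_RInt_gen_scal _ y _ I3)) I1).
  apply (is_RInt_gen_unique (V := R_CompleteNormedModule)) in I.
  apply (is_RInt_gen_unique (V := R_CompleteNormedModule)) in J.
  assert (E : s * gamma_phase (s, y) phi + y * gamma_phase (s, y) (phi + PI / 2)
     - gamma_phase ((s, y) + 1)%C phi = 0 - 0).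
  { rewrite <- I. symmetry. exact J. }
  replace (gamma_phase ((s, y) + 1)%C phi) with
    (s * gamma_phase (s, y) phi + y * gamma_phase (s, y) (phi + PI / 2)) by lra.
  unfold gamma_phase. rewrite cos_plus, sin_plus, cos_PI2, sin_PI2.
  destruct (CGamma (s, y)) as [a b]. simpl. ring.
Qed.

(** * Gamma on the positive real axis *)

Definition RGamma (s : R) : R := Re (CGamma (RtoC s)).

Lemma is_RInt_gen_RGamma (s : R) : 0 < s ->
  is_RInt_gen (fun x => exp (- x) * Rpower x (s - 1)) F0 Foo (RGamma s).
Proof.
  intros Hs.
  assert (H := is_RInt_gen_gamma_phase (RtoC s) 0 Hs).
  unfold gamma_phase in H. rewrite cos_0, sin_0 in H.
  replace (1 * _ - 0 * _) with (RGamma s) in H by (unfold RGamma; ring).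
  apply is_RInt_gen_pos_ext with (2 := H). intros x Hx.
  unfold gamma_wave. simpl. replace (0 * ln x + 0) with 0 by ring. rewrite cos_0. ring.
Qed.

Lemma RGamma_plus_1 (s : R) : 0 < s -> RGamma (s + 1) = s * RGamma s.
Proof.
  intros Hs. unfold RGamma. rewrite RtoC_plus, CGamma_plus_1 by exact Hs.
  simpl. ring.
Qed.

Lemma RGamma_1 : RGamma 1 = 1.
Proof.
  assert (H := is_RInt_gen_RGamma 1 Rlt_0_1).
  apply (is_RInt_gen_unique (V := R_CompleteNormedModule)) in H. rewrite <- H. clear H.
  apply (is_RInt_gen_unique (V := R_CompleteNormedModule)).
  assert (I : is_RInt_gen (fun x => exp (- x) * Rpower x (1 - 1)) F0 Foo (0 - - 1));
    [|replace (0 - - 1) with 1 in I by ring; exact I].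
  apply is_RInt_gen_pos_derive with (fun x => - exp (- x)).
  - intros x Hx. auto_derive; trivial. replace (1 - 1) with 0 by ring.
    rewrite Rpower_O by trivial. ring.
  - intros x Hx. apply (ex_derive_continuous (V := R_NormedModule)).
    unfold Rpower. auto_derive. tauto.
  - apply (filterlim_filter_le_1 (F := locally 0)).
    { intros P [d Hd]. exists d. intros v Hv _. apply Hd, Hv. }
    assert (Hc : continuous (fun x => - exp (- x)) 0).
    { apply (ex_derive_continuous (V := R_NormedModule)). auto_derive. trivial. }
    unfold continuous in Hc. rewrite Ropp_0, exp_0 in Hc. exact Hc.
  - apply filterlim_squeeze_0 with (fun x => / x); [typeclasses eauto| |].
    + exists 0. intros x Hx. rewrite Rabs_Ropp, Rabs_pos_eq by (left; apply exp_pos).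
      rewrite exp_Ropp. apply Rinv_le_contravar; trivial.
      generalize (exp_ineq1_le x). lra.
    + apply (filterlim_Rbar_inv p_infty). discriminate.
Qed.

(* Integrate [x ^ s >= m ^ s (1 + s ln (x / m)) >= m ^ s (1 + s (1 - m / x))] against
   [x ^ m e ^ (- x)]. *)
Lemma RGamma_growth (m s : R) : 0 < m -> 0 <= s ->
  Rpower m s * RGamma (m + 1) <= RGamma (m + 1 + s).
Proof.
  intros Hm Hs.
  assert (I1 : is_RInt_gen _ F0 Foo (RGamma (m + 1 + s))) by (apply is_RInt_gen_RGamma; lra).
  assert (I2 : is_RInt_gen _ F0 Foo (RGamma (m + 1))) by (apply is_RInt_gen_RGamma; lra).
  assert (I3 : is_RInt_gen _ F0 Foo (RGamma m)) by (apply is_RInt_gen_RGamma; lra).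
  assert (J := is_RInt_gen_minus _ _ _ _
      (is_RInt_gen_scal _ (Rpower m s * (1 + s)) _ I2)
      (is_RInt_gen_scal _ (Rpower m s * (s * m)) _ I3)).
  assert (L := fun H => is_RInt_gen_pos_le _ _ _ _ H J I1).
  eapply Rle_trans; [|apply L; clear L J].
  (* The terms with factor [s] cancel because [RGamma (m + 1) = m * RGamma m]. *)
  - right. change (Rpower m s * RGamma (m + 1) =
      Rpower m s * (1 + s) * RGamma (m + 1) - Rpower m s * (s * m) * RGamma m).
    rewrite RGamma_plus_1 by trivial. ring.
  - intros x Hx.
    change (Rpower m s * (1 + s) * (exp (- x) * Rpower x (m + 1 - 1))
      - Rpower m s * (s * m) * (exp (- x) * Rpower x (m - 1))
      <= exp (- x) * Rpower x (m + 1 + s - 1)).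
    replace (m + 1 + s - 1) with (s + (m - 1) + 1) by ring.
    replace (m + 1 - 1) with (m - 1 + 1) by ring.
    rewrite !Rpower_plus, !(Rpower_1 x Hx).
    assert (P : 0 < exp (- x) * Rpower x (m - 1)).
    { apply Rmult_lt_0_compat; apply exp_pos. }
    set (w := exp (- x) * Rpower x (m - 1)) in *.
    assert (E : Rpower m s * (x * (1 + s) - s * m) <= Rpower x s * x).
    { assert (Ex : Rpower x s = Rpower m s * exp (s * (ln x - ln m))).
      { unfold Rpower. rewrite <- exp_plus. f_equal. ring. }
      rewrite Ex, Rmult_assoc. apply Rmult_le_compat_l; [left; apply exp_pos|].
      assert (E1 := exp_ineq1_le (s * (ln x - ln m))).
      assert (E2 := exp_ineq1_le (ln (m / x))).
      rewrite exp_ln in E2 by (apply Rdiv_lt_0_compat; lra).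
      rewrite ln_div in E2 by lra.
      assert (E3 : s * (1 - m / x) <= s * (ln x - ln m)) by (apply Rmult_le_compat_l; lra).
      apply Rle_trans with ((1 + s * (1 - m / x)) * x); [right; field; lra|].
      apply Rmult_le_compat_r; lra. }
    apply Rmult_le_compat_l with (r := w) in E; [|lra]. unfold w in E |- *. lra.
Qed.

(** The growth bound at [m = 1] makes [RGamma (s + 2) = (s + 1) * (s * RGamma s)] positive. *)
Lemma RGamma_pos (s : R) : 0 < s -> 0 < RGamma s.
Proof.
  intros Hs. assert (H := RGamma_growth 1 s Rlt_0_1 (Rlt_le _ _ Hs)).
  replace (1 + 1 + s) with (s + 1 + 1) in H by ring.
  rewrite !RGamma_plus_1, RGamma_1 in H by lra.
  assert (P := Rpower_pos 1 s). nra.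
Qed.

(** * Lower bounds for the modulus of Gamma off the real axis *)

Lemma cos_ge_parabola (th : R) : 1 - th ^ 2 / 2 <= cos th.
Proof.
  assert (H : forall v, 0 <= v -> 1 - v ^ 2 / 2 <= cos v).
  { intros v Hv. destruct (Rle_dec 2 v) as [H2|H2].
    { generalize (COS_bound v). nra. }
    replace (cos v) with (cos (2 * (v / 2))) by (f_equal; field).
    rewrite cos_2a_sin.
    assert (S0 : 0 <= sin (v / 2)) by (apply sin_ge_0; generalize PI2_1; lra).
    assert (S1 : sin (v / 2) <= v / 2).
    { destruct Hv as [Hv|Hv]; [left; apply sin_lt_x; lra|].
      rewrite <- Hv, Rdiv_0_l, sin_0. lra. }
    nra. }
  destruct (Rle_dec 0 th) as [Hth|Hth]; [auto|].
  rewrite <- cos_neg. replace (th ^ 2) with ((- th) ^ 2) by ring. apply H. lra.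
Qed.

(** With [v = ln u / 2], the right side is [4 (e ^ v - e ^ (- v)) ^ 2], and
    [|v| <= |e ^ v - e ^ (- v)|]. This bound replaces the logarithm by powers of [u], whose Gamma
    integrals are explicit. *)
Lemma ln_sqr_le (u : R) : 0 < u -> ln u ^ 2 <= 4 * (u - 2 + / u).
Proof.
  intros Hu. rewrite <- (exp_ln u Hu) at 2 3. rewrite <- exp_Ropp.
  set (l := ln u). set (v := l / 2).
  replace l with (v + v) by (unfold v; field). rewrite Ropp_plus_distr, !exp_plus.
  assert (E : exp v * exp (- v) = 1).
  { rewrite <- exp_plus, <- exp_0. f_equal. ring. }
  assert (A1 := exp_ineq1_le v). assert (A2 := exp_ineq1_le (- v)).
  assert (P1 := exp_pos v). assert (P2 := exp_pos (- v)).
  destruct (Rle_dec 0 v) as [Hv|Hv].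
  - assert (exp (- v) <= 1) by nra.
    assert (v <= exp v - exp (- v)) by lra. nra.
  - assert (exp v <= 1) by nra.
    assert (- v <= exp (- v) - exp v) by lra. nra.
Qed.

(** Rotation preserves the modulus, which bounds the real part; in coordinates this is the
    Cauchy-Schwarz inequality, with the square [Q] as its defect. *)
Lemma gamma_phase_le_Cmod (z : C) (phi : R) : gamma_phase z phi <= Cmod (CGamma z).
Proof.
  unfold gamma_phase. destruct (CGamma z) as [a b]. unfold Cmod. simpl.
  apply Rle_trans with (1 := Rle_abs _).
  rewrite <- sqrt_Rsqr_abs. apply sqrt_le_1_alt.
  assert (H := sin2_cos2 phi). unfold Rsqr in *.
  assert (Q : 0 <= (cos phi * b + sin phi * a) ^ 2) by apply pow2_ge_0.
  replace (a * (a * 1) + b * (b * 1)) with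
    ((sin phi * sin phi + cos phi * cos phi) * (a * a + b * b)) by (rewrite H; ring).
  lra.
Qed.

(** Rotating by [- y ln s] turns the cosine into [cos (y ln (x / s))], which is at least
    [1 - 2 y ^ 2 (x / s - 2 + s / x)]. Under the Gamma density of parameter [s], the mean of [x / s]
    is [1] and that of [s / x] is [s / (s - 1)]. *)
Lemma Cmod_CGamma_ge_concentration (z : C) : 1 < Re z ->
  RGamma (Re z) * (1 - 2 * Im z ^ 2 / (Re z - 1)) <= Cmod (CGamma z).
Proof.
  intros Hz. destruct z as [s y]. simpl (Re _) in *. simpl (Im _).
  eapply Rle_trans; [|apply (gamma_phase_le_Cmod _ (- (y * ln s)))].
  assert (I : is_RInt_gen _ F0 Foo (gamma_phase (s, y) (- (y * ln s))))
    by (apply is_RInt_gen_gamma_phase; simpl; lra).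
  assert (I1 : is_RInt_gen _ F0 Foo (RGamma s)) by (apply is_RInt_gen_RGamma; lra).
  assert (I2 : is_RInt_gen _ F0 Foo (RGamma (s + 1))) by (apply is_RInt_gen_RGamma; lra).
  assert (I3 : is_RInt_gen _ F0 Foo (RGamma (s - 1))) by (apply is_RInt_gen_RGamma; lra).
  (* The weights are the coefficients of [1], [x] and [1 / x] in that lower bound. *)
  assert (J := is_RInt_gen_minus _ _ _ _ (is_RInt_gen_minus _ _ _ _
      (is_RInt_gen_scal _ (1 + 4 * y ^ 2) _ I1)
      (is_RInt_gen_scal _ (2 * y ^ 2 / s) _ I2))
      (is_RInt_gen_scal _ (2 * y ^ 2 * s) _ I3)).
  assert (L := fun H => is_RInt_gen_pos_le _ _ _ _ H J I).
  eapply Rle_trans; [|apply L; clear L J].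
  - right. change (RGamma s * (1 - 2 * y ^ 2 / (s - 1)) = (1 + 4 * y ^ 2) * RGamma s
      - 2 * y ^ 2 / s * RGamma (s + 1) - 2 * y ^ 2 * s * RGamma (s - 1)).
    rewrite RGamma_plus_1 by lra.
    replace (RGamma s) with ((s - 1) * RGamma (s - 1)).
    + field. lra.
    + rewrite <- RGamma_plus_1 by lra. f_equal. ring.
  - intros x Hx.
    change ((1 + 4 * y ^ 2) * (exp (- x) * Rpower x (s - 1))
      - 2 * y ^ 2 / s * (exp (- x) * Rpower x (s + 1 - 1))
      - 2 * y ^ 2 * s * (exp (- x) * Rpower x (s - 1 - 1))
      <= exp (- x) * Rpower x (s - 1) * cos (y * ln x + - (y * ln s))).
    replace (s + 1 - 1) with (s - 1 + 1) by ring.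
    replace (s - 1 - 1) with (s - 1 + - (1)) by ring.
    rewrite !Rpower_plus, Rpower_Ropp, !(Rpower_1 x Hx).
    assert (P : 0 < exp (- x) * Rpower x (s - 1)).
    { apply Rmult_lt_0_compat; apply exp_pos. }
    set (w := exp (- x) * Rpower x (s - 1)) in *.
    apply Rle_trans with (w * (1 - 2 * (y ^ 2 * (x / s - 2 + / (x / s))))).
    { right. unfold w. field. lra. }
    apply Rmult_le_compat_l; [lra|].
    replace (y * ln x + - (y * ln s)) with (y * ln (x / s)) by (rewrite ln_div by lra; ring).
    eapply Rle_trans; [|apply cos_ge_parabola].
    assert (Hu : 0 < x / s) by (apply Rdiv_lt_0_compat; lra).
    assert (E := ln_sqr_le _ Hu).
    apply Rmult_le_compat_l with (r := y ^ 2) in E; [|apply pow2_ge_0].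
    rewrite Rpow_mult_distr. lra.
Qed.

Lemma exp_le_compat (x y : R) : x <= y -> exp x <= exp y.
Proof.
  intros [H|H]; [left; apply exp_increasing, H|rewrite H; right; reflexivity].
Qed.

(** Squared, this is [s ^ 2 (1 + y ^ 2 / s ^ 2) <= s ^ 2 e ^ (y ^ 2 / s ^ 2)]. It controls the loss
    in one use of the functional equation. *)
Lemma Cmod_le_exp (z : C) : 0 < Re z ->
  Cmod z <= Re z * exp (Im z ^ 2 / (2 * Re z ^ 2)).
Proof.
  destruct z as [s y]. simpl (Re _). simpl (Im _). intros Hs.
  assert (P := exp_pos (y ^ 2 / (2 * s ^ 2))).
  apply Rsqr_incr_0_var; [|nra].
  unfold Rsqr, Cmod. rewrite sqrt_sqrt by (simpl; nra).
  replace (s * exp (y ^ 2 / (2 * s ^ 2)) * (s * exp (y ^ 2 / (2 * s ^ 2)))) with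
    (s ^ 2 * exp (y ^ 2 / s ^ 2)).
  - assert (E := exp_ineq1_le (y ^ 2 / s ^ 2)).
    simpl fst. simpl snd. apply Rle_trans with (s ^ 2 * (1 + y ^ 2 / s ^ 2)).
    + right. field. lra.
    + apply Rmult_le_compat_l; [nra|trivial].
  - replace (y ^ 2 / s ^ 2) with (y ^ 2 / (2 * s ^ 2) + y ^ 2 / (2 * s ^ 2)) by (field; lra).
    rewrite exp_plus. ring.
Qed.

(* The concentration bound is applied at [z + n], and Gamma is brought back to [z]
   by its functional equation. *)
Lemma Cmod_CGamma_ge (z : C) : 1 < Re z ->
  RGamma (Re z) / 2 <= Cmod (CGamma z) * exp (Im z ^ 2 / (2 * (Re z - 1))).
Proof.
  intros Hz. destruct (INR_unbounded (4 * Im z ^ 2)) as [n Hn].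
  (* At [n = 0] this threshold makes the concentration factor at least [1 / 2]; each shift by [1]
     lowers the required [n] by one. *)
  assert (Hn' : 4 * Im z ^ 2 <= Re z - 1 + INR n) by lra. clear Hn.
  revert z Hz Hn'. induction n as [|n IH]; intros [s y]; simpl (Re _); simpl (Im _);
    intros Hs Hn.
  - simpl INR in Hn. assert (H := Cmod_CGamma_ge_concentration (s, y) Hs).
    simpl (Re _) in H. simpl (Im _) in H. assert (G := RGamma_pos s ltac:(lra)).
    assert (Q : 2 * y ^ 2 / (s - 1) <= / 2) by (apply Rle_div_l; lra).
    assert (E := exp_ineq1_le (y ^ 2 / (2 * (s - 1)))).
    assert (Q0 : 0 <= y ^ 2 / (2 * (s - 1))) by (apply Rdiv_le_0_compat; nra).
    assert (Cg := Cmod_ge_0 (CGamma (s, y))). nra.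
  - rewrite S_INR in Hn. assert (H := IH ((s, y) + 1)%C).
    rewrite CGamma_plus_1, Cmod_mult in H by (simpl; lra).
    simpl (Re _) in H. simpl (Im _) in H. rewrite Rplus_0_r in H.
    specialize (H ltac:(lra) ltac:(lra)). rewrite RGamma_plus_1 in H by lra.
    assert (E := Cmod_le_exp (s, y) ltac:(simpl; lra)).
    simpl (Re _) in E. simpl (Im _) in E.
    assert (Cg := Cmod_ge_0 (CGamma (s, y))).
    set (G := Cmod (CGamma (s, y))) in *.
    replace (s + 1 - 1) with s in H by ring.
    apply Rmult_le_reg_l with s; [lra|].
    apply Rle_trans with (s * RGamma s / 2); [right; field|].
    apply Rle_trans with (1 := H).
    apply Rle_trans with (s * exp (y ^ 2 / (2 * s ^ 2)) * G * exp (y ^ 2 / (2 * s))).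
    { apply Rmult_le_compat_r; [left; apply exp_pos|].
      apply Rmult_le_compat_r; trivial. }
    apply Rle_trans with (s * (G * exp (y ^ 2 / (2 * s ^ 2) + y ^ 2 / (2 * s)))).
    { right. rewrite exp_plus. ring. }
    apply Rmult_le_compat_l; [lra|]. apply Rmult_le_compat_l; trivial.
    apply exp_le_compat.
    (* The exponents compare because [1 / s ^ 2 + 1 / s <= 1 / (s - 1)], that is,
       [(s + 1) (s - 1) <= s ^ 2]. *)
    replace (y ^ 2 / (2 * s ^ 2) + y ^ 2 / (2 * s)) with
      (y ^ 2 / 2 * ((1 + s) / s ^ 2)) by (field; lra).
    replace (y ^ 2 / (2 * (s - 1))) with (y ^ 2 / 2 * (1 / (s - 1))) by (field; lra).
    apply Rmult_le_compat_l; [nra|].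
    apply Rle_div_l; [nra|].
    apply Rmult_le_reg_l with (s - 1); [lra|].
    apply Rle_trans with (s ^ 2); [nra|right; field; lra].
Qed.

(** A zero at [z] would be one at [z + 1] by the functional equation, where the real part exceeds
    [1] and the lower bound is positive. *)
Lemma CGamma_neq_0 (z : C) : 0 < Re z -> CGamma z <> 0.
Proof.
  intros Hz H0.
  assert (H := Cmod_CGamma_ge (z + 1)%C).
  rewrite CGamma_plus_1, H0, Cmult_0_r, Cmod_0 in H by trivial.
  assert (Hz1 : 1 < Re (z + 1)%C) by (destruct z; simpl in *; lra).
  specialize (H Hz1). assert (P := RGamma_pos (Re (z + 1)%C) ltac:(lra)). lra.
Qed.

(** * Superexponential growth and infinite radius of convergence *)

Lemma bounded_of_eventually (u : nat -> R) (K : R) (N : nat) :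
  (forall n, (N <= n)%nat -> u n <= K) -> exists M, forall n, u n <= M.
Proof.
  revert K. induction N as [|N IH]; intros K H.
  - exists K. intros n. apply H. lia.
  - apply (IH (Rmax K (u N))). intros n Hn.
    destruct (Nat.eq_dec n N) as [->|Hne]; [apply Rmax_r|].
    apply Rle_trans with (2 := Rmax_l _ _). apply H. lia.
Qed.

(** The base [m = e ^ B] turns [m ^ s] in [RGamma_growth] into [e ^ (B s)]; the constant absorbs the
    shift by [m + 1]. *)
Lemma RGamma_ge_exp (B : R) : 0 <= B -> exists c, 0 < c /\
  forall s, exp B + 1 <= s -> c * exp (B * s) <= RGamma s.
Proof.
  intros HB. set (m := exp B). assert (Hm : 0 < m) by apply exp_pos.
  exists (RGamma (m + 1) * exp (- (B * (m + 1)))). split.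
  - apply Rmult_lt_0_compat; [apply RGamma_pos; lra|apply exp_pos].
  - intros s Hs. assert (H := RGamma_growth m (s - (m + 1)) Hm ltac:(lra)).
    replace (m + 1 + (s - (m + 1))) with s in H by ring.
    apply Rle_trans with (2 := H). right.
    unfold Rpower. replace (ln m) with B by (symmetry; apply ln_exp).
    rewrite Rmult_assoc, <- exp_plus, Rmult_comm. f_equal. f_equal. ring.
Qed.

Lemma CGamma_ray_superexponential (mu kappa : C) (r : R) :
  0 < Re mu -> 0 < Re kappa -> 0 < r ->
  exists M, forall n : nat, / Cmod (CGamma (mu * RtoC (INR n) + kappa)%C) * r ^ n <= M.
Proof.
  intros Hmu Hka Hr.
  set (a := Re mu) in *. set (b := Re kappa) in *.
  (* [A] bounds [|Im z| / Re z] along the whole ray, so the exponential loss in [Cmod_CGamma_ge] is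
     at most [e ^ (A ^ 2 s)]. *)
  set (A := Rabs (Im mu) / a + Rabs (Im kappa) / b).
  assert (HA1 : 0 <= Rabs (Im mu) / a) by (apply Rdiv_le_0_compat; [apply Rabs_pos|trivial]).
  assert (HA2 : 0 <= Rabs (Im kappa) / b) by (apply Rdiv_le_0_compat; [apply Rabs_pos|trivial]).
  (* [E] is chosen so that [r ^ n <= e ^ (E s)]; growth of rate [A ^ 2 + E] then pays for both
     factors. *)
  set (E := Rabs (ln r) / a).
  assert (HE : 0 <= E) by (apply Rdiv_le_0_compat; [apply Rabs_pos|trivial]).
  assert (HB : 0 <= A ^ 2 + E) by nra.
  destruct (RGamma_ge_exp _ HB) as [c [Hc HG]].
  set (m := exp (A ^ 2 + E)) in *.
  (* With [s >= m + 1] this gives [s >= 2], hence [s <= 2 (s - 1)], as the exponent bound [Hexp]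
     requires. *)
  assert (Hm : 1 <= m) by (rewrite <- exp_0; apply exp_le_compat; trivial).
  destruct (INR_archimed a (m + 1) Hmu) as [N HN].
  apply (bounded_of_eventually _ (2 / c) N). intros n Hn.
  apply le_INR in Hn. set (z := (mu * RtoC (INR n) + kappa)%C).
  assert (Hsz : Re z = a * INR n + b) by (unfold z, a, b; destruct mu, kappa; simpl; ring).
  assert (Hyz : Im z = Im mu * INR n + Im kappa)
    by (unfold z; destruct mu, kappa; simpl; ring).
  set (s := Re z) in *. set (y := Im z) in *.
  assert (HaN : a * INR N <= a * INR n) by (apply Rmult_le_compat_l; lra).
  assert (Hs : m + 1 <= s) by lra.
  assert (Hy : Rabs y <= A * s).
  { rewrite Hyz, Hsz. eapply Rle_trans; [apply Rabs_triang|].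
    assert (P := pos_INR n).
    rewrite Rabs_mult, (Rabs_pos_eq (INR n)) by trivial.
    replace (A * (a * INR n + b)) with (Rabs (Im mu) * INR n + Rabs (Im kappa)
       + (Rabs (Im mu) / a * b + Rabs (Im kappa) / b * (a * INR n)))
      by (unfold A; field; lra).
    assert (0 <= Rabs (Im mu) / a * b) by nra.
    assert (0 <= Rabs (Im kappa) / b * (a * INR n)).
    { apply Rmult_le_pos; [trivial|nra]. }
    lra. }
  assert (Hy2 : y ^ 2 <= A ^ 2 * s ^ 2).
  { rewrite <- Rpow_mult_distr, <- (pow2_abs y). apply pow_incr.
    split; [apply Rabs_pos|trivial]. }
  assert (Hexp : y ^ 2 / (2 * (s - 1)) <= A ^ 2 * s).
  { apply Rle_div_l; [lra|]. apply Rle_trans with (1 := Hy2).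
    replace (A ^ 2 * s * (2 * (s - 1))) with (A ^ 2 * (s * (2 * (s - 1)))) by ring.
    apply Rmult_le_compat_l; [apply pow2_ge_0|]. nra. }
  assert (H := Cmod_CGamma_ge z ltac:(fold s; lra)). fold s in H. fold y in H.
  assert (HG' := HG s Hs).
  assert (Hrn : r ^ n <= exp (E * s)).
  { rewrite <- Rpower_pow by trivial. unfold Rpower. apply exp_le_compat.
    assert (P := pos_INR n). rewrite Hsz.
    replace (E * (a * INR n + b)) with (INR n * Rabs (ln r) + E * b)
      by (unfold E; field; lra).
    assert (INR n * ln r <= INR n * Rabs (ln r))
      by (apply Rmult_le_compat_l; [trivial|apply Rle_abs]).
    nra. }
  assert (Hlow : c / 2 * exp (E * s) <= Cmod (CGamma z)).
  { apply Rmult_le_reg_r with (exp (A ^ 2 * s)); [apply exp_pos|].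
    apply Rle_trans with (c * exp ((A ^ 2 + E) * s) / 2).
    { right. replace ((A ^ 2 + E) * s) with (E * s + A ^ 2 * s) by ring.
      rewrite exp_plus. field. }
    apply Rle_trans with (RGamma s / 2); [lra|].
    apply Rle_trans with (1 := H).
    apply Rmult_le_compat_l; [apply Cmod_ge_0|]. apply exp_le_compat, Hexp. }
  assert (P := exp_pos (E * s)).
  assert (Hpos : 0 < Cmod (CGamma z)) by nra.
  rewrite Rmult_comm. apply Rle_div_l; [trivial|].
  apply Rle_trans with (1 := Hrn).
  apply Rle_trans with (2 / c * (c / 2 * exp (E * s))); [right; field; lra|].
  apply Rmult_le_compat_l; [|trivial].
  apply Rdiv_le_0_compat; lra.
Qed.

Lemma CV_radius_infinite_bounded (a : nat -> R) :
  (forall r, 0 < r -> exists M, forall n, Rabs (a n) * r ^ n <= M) ->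
  CV_radius a = p_infty.
Proof.
  intros H. destruct (CV_radius_bounded a) as [Hub _].
  assert (Hge : forall r, 0 < r -> Rbar_le r (CV_radius a)).
  { intros r Hr. apply Hub. destruct (H r Hr) as [M HM]. exists M. intros n.
    rewrite Rabs_mult, <- RPow_abs, (Rabs_pos_eq r) by lra. apply HM. }
  destruct (CV_radius a) as [l| |]; trivial.
  (* A finite radius [l] is refuted by the larger positive number [Rabs l + 1]. *)
  - assert (K := Hge (Rabs l + 1)). simpl in K.
    assert (P := Rabs_pos l). assert (Q := Rle_abs l). specialize (K ltac:(lra)). lra.
  - destruct (Hge 1 Rlt_0_1).
Qed.

(** [proj] stands for [Re] or [Im]: the complex series is treated as two real power series. *)
Lemma CV_radius_recip_CGamma (mu kappa : C) (proj : C -> R) :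
  (forall w, Rabs (proj w) <= Cmod w) -> 0 < Re mu -> 0 < Re kappa ->
  CV_radius (fun k => proj (/ CGamma (mu * RtoC (INR k) + kappa))%C) = p_infty.
Proof.
  intros Hproj Hmu Hka. apply CV_radius_infinite_bounded. intros r Hr.
  destruct (CGamma_ray_superexponential mu kappa r Hmu Hka Hr) as [M HM].
  exists M. intros n. apply Rle_trans with (2 := HM n).
  apply Rmult_le_compat_r; [apply pow_le; lra|].
  rewrite <- Cmod_inv; [apply Hproj|].
  apply CGamma_neq_0. assert (P := pos_INR n). destruct mu, kappa; simpl in *. nra.
Qed.

(** * Mittag-Leffler functions as pairs of real power series *)

Lemma im_le_Cmod (w : C) : Rabs (Im w) <= Cmod w.
Proof.
  destruct w as [a b]. apply Rle_trans with (2 := Rmax_Cmod (a, b)). apply Rmax_r.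
Qed.

Lemma Re_RtoC_mult (x : R) (w : C) : Re (RtoC x * w)%C = x * Re w.
Proof. destruct w; simpl; ring. Qed.

Lemma Im_RtoC_mult (x : R) (w : C) : Im (RtoC x * w)%C = x * Im w.
Proof. destruct w; simpl; ring. Qed.

Definition ML_coef (mu kappa : C) (k : nat) : C :=
  (/ CGamma (mu * RtoC (INR k) + kappa))%C.

Lemma ML2_PSeries (mu kappa : C) (x : R) :
  ML2 mu kappa (RtoC x) = (PSeries (fun k => Re (ML_coef mu kappa k)) x,
                           PSeries (fun k => Im (ML_coef mu kappa k)) x).
Proof.
  unfold ML2, CSeries, PSeries, ML_coef, Cdiv. f_equal; apply Series_ext; intros k;
    rewrite <- RtoC_pow, ?Re_RtoC_mult, ?Im_RtoC_mult; ring.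
Qed.

Lemma poch_0 (z : C) : 0 < Re z -> poch z 0 = 1.
Proof.
  intros Hz. unfold poch. rewrite Cplus_0_r. field. apply CGamma_neq_0, Hz.
Qed.

Lemma poch_plus_1 (z : C) (s : R) : 0 < Re z -> 0 <= s ->
  poch z (s + 1) = ((z + RtoC s) * poch z s)%C.
Proof.
  intros Hz Hs. unfold poch. rewrite RtoC_plus, Cplus_assoc, CGamma_plus_1.
  - unfold Cdiv. ring.
  - destruct z; simpl in *; lra.
Qed.

(** Induction by the functional equation gives [(2)_k = (k + 1)!]; the quotient is the factor
    produced by termwise differentiation. *)
Lemma poch_2_fact (k : nat) : (poch (RtoC 2) (INR k) / RtoC (INR (fact k)))%C = RtoC (INR (S k)).
Proof.
  assert (H : poch (RtoC 2) (INR k) = RtoC (INR (fact (S k)))).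
  { induction k as [|k IH].
    - simpl INR. rewrite poch_0 by (simpl; lra). reflexivity.
    - rewrite S_INR, poch_plus_1, IH by (try apply pos_INR; simpl; lra).
      rewrite (fact_simpl (S k)), mult_INR, RtoC_mult. f_equal.
      rewrite <- RtoC_plus. f_equal. rewrite !S_INR. ring. }
  rewrite H, fact_simpl, mult_INR, RtoC_mult. field.
  intros K. apply RtoC_inj in K. exact (INR_fact_neq_0 k K).
Qed.

(** Differentiation shifts the index by one, which matches
    [mu k + (mu + kappa) = mu (k + 1) + kappa]. *)
Lemma ML3_2_PSeries (mu kappa : C) (x : R) :
  ML3 (RtoC 2) mu (mu + kappa) (RtoC x) =
   (PSeries (PS_derive (fun k => Re (ML_coef mu kappa k))) x,
    PSeries (PS_derive (fun k => Im (ML_coef mu kappa k))) x).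
Proof.
  unfold ML3, CSeries, PSeries, PS_derive, ML_coef.
  f_equal; apply Series_ext; intros k; rewrite poch_2_fact, <- RtoC_pow; unfold Cdiv;
  replace (mu * RtoC (INR k) + (mu + kappa))%C
    with (mu * RtoC (INR (S k)) + kappa)%C by (rewrite S_INR, RtoC_plus; ring);
  rewrite ?Re_RtoC_mult, ?Im_RtoC_mult; ring.
Qed.

(** * The polynomial [H_trunc] and the chain rule *)

Lemma is_derive_sum_pow (r : nat -> R) (w : R) (j : nat) :
  is_derive (fun e => sum_n (fun k => r k * (e * w) ^ k) (S j)) 0 (r 1%nat * w).
Proof.
  induction j as [|j IH].
  - apply is_derive_ext with (fun e => r 0%nat + r 1%nat * (e * w)).
    + intros e. rewrite sum_Sn, sum_O. unfold plus. simpl. ring.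
    + auto_derive; trivial. ring.
  - apply is_derive_ext with (fun e => plus (sum_n (fun k => r k * (e * w) ^ k) (S j))
      (r (S (S j)) * (e * w) ^ S (S j))).
    + intros e. symmetry. apply sum_Sn.
    (* A term of degree at least two has derivative [0] at [0]. *)
    + replace (r 1%nat * w) with (plus (r 1%nat * w) 0) by apply Rplus_0_r.
      apply (is_derive_plus (V := R_NormedModule)); [exact IH|].
      auto_derive; trivial. simpl. ring.
Qed.

Lemma sum_n_pow_0 (r : nat -> R) (w : R) (j : nat) :
  sum_n (fun k => r k * (0 * w) ^ k) j = r 0%nat.
Proof.
  induction j as [|j IH].
  - rewrite sum_O. simpl. ring.
  - rewrite sum_Sn, IH. unfold plus. simpl. ring.
Qed.

Lemma Re_H_trunc (i : nat) (gamma beta rho delta : C) (p q x : R) :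
  Re (H_trunc i gamma beta rho delta p q (RtoC x)) =
  sum_n (fun k => Re (H_coef gamma beta rho delta p q k) * x ^ k) i.
Proof.
  assert (T : forall k, Re (H_coef gamma beta rho delta p q k * Cpow (RtoC x) k)%C =
     Re (H_coef gamma beta rho delta p q k) * x ^ k).
  { intros k. rewrite <- RtoC_pow, Cmult_comm, Re_RtoC_mult. ring. }
  unfold H_trunc. induction i as [|i IH].
  - rewrite !sum_O. apply T.
  - rewrite !sum_Sn, <- IH, <- T. reflexivity.
Qed.

Lemma H_coef_0 (gamma beta rho delta : C) (p q : R) :
  0 < Re beta -> 0 < Re rho -> 0 < Re delta -> H_coef gamma beta rho delta p q 0 = 1.
Proof.
  intros Hb Hr Hd. unfold H_coef. simpl INR.
  rewrite !Rmult_0_r, !poch_0, Cmult_0_r, Cplus_0_l by trivial.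
  field. apply CGamma_neq_0, Hb.
Qed.

(** Puts differentiability at [0] into the punctured-neighbourhood form of [is_V_derivative]. *)
Lemma filterlim_diff_quotient (g : R -> R) (l : R) : is_derive g 0 l ->
  filterlim (fun e => (g e - g 0) / e) (locally' 0) (locally l).
Proof.
  intros H. apply is_derive_Reals in H. apply filterlim_locally. intros eps.
  destruct (H eps (cond_pos eps)) as [d Hd]. exists d. intros e He Hne.
  change (Rabs (e - 0) < d) in He. rewrite Rminus_0_r in He.
  assert (K := Hd e Hne He). rewrite Rplus_0_l in K. exact K.
Qed.

Theorem theorem17 (gamma beta rho delta : C) (p q : R) (i : nat)
    (mu kappa : C) (alpha t : R)
    (hgamma : 0 < Re gamma) (hbeta : 0 < Re beta)
    (hrho : 0 < Re rho) (hdelta : 0 < Re delta)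
    (hp : 0 < p) (hq : 0 < q) (hpq : q <= Re gamma + p) (hi : (1 <= i)%nat)
    (hreal : forall k : nat, (k <= i)%nat ->
       Im (H_coef gamma beta rho delta p q k) = 0)
    (halpha0 : 0 < alpha) (halpha1 : alpha < 1)
    (hmu : 0 < Re mu) (hkappa : 0 < Re kappa) (ht : 0 < t) :
  is_V_derivative i gamma beta rho delta p q alpha
    (fun x : R => ML2 mu kappa (RtoC x)) t
    (RtoC (Rpower t (1 - alpha))
     * (CGamma beta * poch rho q / (CGamma (gamma + beta) * poch delta p))
     * ML3 (RtoC 2) mu (mu + kappa) (RtoC t))%C.
Proof.
  set (h := H_coef gamma beta rho delta p q) in *.
  set (w := Rpower t (- alpha)).
  (* The argument of [f] as a function of [e]; since [u 0 = t], the limit sought is the derivative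
     at [0] of [f] composed with [u]. *)
  set (u := fun e : R => t * sum_n (fun k => Re (h k) * (e * w) ^ k) i).
  assert (Hu0 : u 0 = t).
  { unfold u. rewrite sum_n_pow_0. unfold h. rewrite H_coef_0 by trivial. simpl. ring. }
  set (D := t * (Re (h 1%nat) * w)).
  assert (Hu : is_derive u 0 D).
  { destruct i as [|j]; [lia|]. unfold u, D.
    apply (is_derive_scal _ 0 t), is_derive_sum_pow. }
  assert (HD : (RtoC (Rpower t (1 - alpha))
     * (CGamma beta * poch rho q / (CGamma (gamma + beta) * poch delta p)))%C = RtoC D).
  { assert (Hh1 : h 1%nat = (CGamma beta * poch rho q /
             (CGamma (gamma + beta) * poch delta p))%C).
    { unfold h, H_coef, Cdiv. simpl INR. rewrite !Rmult_1_r, Cmult_1_r.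
      unfold poch. field.
      repeat split; apply CGamma_neq_0; destruct gamma, beta, delta; simpl in *; lra. }
    rewrite <- Hh1.
    (* The degree-one coefficient is real by [hreal], which applies because [1 <= i]. *)
    replace (h 1%nat) with (RtoC (Re (h 1%nat))).
    - rewrite <- RtoC_mult. f_equal. unfold D, w.
      replace (1 - alpha) with (1 + - alpha) by ring.
      rewrite Rpower_plus, Rpower_1 by trivial. ring.
    - assert (Hi1 := hreal 1%nat hi). destruct (h 1%nat) as [a b].
      simpl in *. rewrite Hi1. reflexivity. }
  assert (Hcomp : forall proj, (forall v, Rabs (proj v) <= Cmod v) ->
    filterlim (fun e => (PSeries (fun k => proj (ML_coef mu kappa k)) (u e)
                         - PSeries (fun k => proj (ML_coef mu kappa k)) t) / e)
      (locally' 0)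
      (locally (D * PSeries (PS_derive (fun k => proj (ML_coef mu kappa k))) t))).
  { intros proj Hproj. set (a := fun k => proj (ML_coef mu kappa k)).
    assert (K := filterlim_diff_quotient (fun e => PSeries a (u e)) (D * PSeries (PS_derive a) t)).
    cbv beta in K. rewrite Hu0 in K. apply K. clear K.
    (* Chain rule: the outer series has infinite radius, so it is differentiable termwise at
       [u 0 = t]. *)
    apply (is_derive_comp (V := R_NormedModule)); [|exact Hu].
    rewrite Hu0. apply is_derive_PSeries.
    unfold a, ML_coef. rewrite CV_radius_recip_CGamma by trivial. exact I. }
  unfold is_V_derivative. rewrite ML3_2_PSeries, HD.
  apply filterlim_locally. intros eps.
  assert (HRe := proj1 (filterlim_locally _ _) (Hcomp Re re_le_Cmod) eps).
  assert (HIm := proj1 (filterlim_locally _ _) (Hcomp Im im_le_Cmod) eps).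
  (* For [e <> 0] the complex quotient by [RtoC e] splits into the two real quotients. *)
  assert (Hne : locally' 0 (fun e : R => e <> 0)).
  { exists (mkposreal 1 Rlt_0_1). intros e _ He. exact He. }
  generalize (filter_and _ _ Hne (filter_and _ _ HRe HIm)). apply filter_imp.
  intros e [He [B1 B2]].
  rewrite Re_H_trunc. fold h w. fold (u e).
  rewrite !ML2_PSeries.
  set (a := PSeries _ (u e)) in *. set (b := PSeries (fun k => Im _) (u e)) in *.
  set (a0 := PSeries (fun k => Re _) t) in *. set (b0 := PSeries (fun k => Im _) t) in *.
  set (a1 := PSeries (PS_derive (fun k => Re _)) t) in *.
  set (b1 := PSeries (PS_derive (fun k => Im _)) t) in *.
  replace (RtoC D * (a1, b1))%C with (D * a1, D * b1)
    by (unfold Cmult; simpl; f_equal; ring).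
  replace (((a, b) - (a0, b0)) / RtoC e)%C with ((a - a0) / e, (b - b0) / e).
  - split; [exact B1|exact B2].
  - unfold Cdiv. rewrite Cmult_comm, <- RtoC_inv by exact He.
    unfold Cmult; simpl; f_equal; field; exact He.
Qed.
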